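(* Let $G$ be a group, let $Q=\mathrm{Core}(G)$, and let $s(G)=\{x^2 : x\in G\}$. The following are equivalent: (i) $Q$ is connected. (ii) $G=\langle s(G)\rangle$, i.e. $G$ is generated by the squares of its elements. (iii) $G=\{x_1x_2\cdots x_t\,x_t\cdots x_2x_1 : x_i\in G,\ t\in\mathbb{N}\}$.
   Context: A quandle is a set $Q$ with a binary operation $*$ such that every left translation $L_x:Q\to Q$, $y\mapsto x*y$, is bijective, $x*(y*z)=(x*y)*(x*z)$ and $x*x=x$ for all $x,y,z\in Q$. For a group $G$, $\mathrm{Core}(G)$ is the quandle with underlying set $G$ and operation $x*y=xy^{-1}x$. The left multiplication group is $\mathrm{LMlt}(Q)=\langle L_x : x\in Q\rangle\le \mathrm{Sym}(Q)$. A quandle $Q$ is connected if $\mathrm{LMlt}(Q)$ acts transitively on $Q$. *)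

(* Defs.v *)
From HB Require Import structures.
From mathcomp Require Import all_boot all_classical.

Set Implicit Arguments.
Unset Strict Implicit.
Unset Printing Implicit Defensive.

Local Open Scope group_scope.
Local Open Scope classical_set_scope.

(* Groups are MathComp's [groupType]s, which may be infinite; the [choiceType]
   structure they carry is available on every type by classical choice. *)

Definition generated (G : groupType) (S : set G) : set G :=
  smallest (fun H : set G => group_closed (fun x => x \in H)) S.

Section SymmetricGroup.
Variable T : Type.

Record Sym := MkSym { perm_fun :> T -> T; perm_bij : bijective perm_fun }.

HB.instance Definition _ := gen_eqMixin Sym.
HB.instance Definition _ := gen_choiceMixin Sym.

Lemma Sym_ext (f g : Sym) : f =1 g -> f = g.
Proof.
case: f g => [f fb] [g gb] /= /funext fg; subst g.
by congr MkSym; exact: Prop_irrelevance.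
Qed.

Lemma Sym_invP (f : Sym) : exists g : Sym, cancel f g /\ cancel g f.
Proof. by case: f => f fb; case: (fb) => g fK gK; exists (MkSym (Bijective gK fK)). Qed.

Definition Sym_one : Sym := MkSym (Bijective (frefl id : cancel id id) (frefl id)).
Definition Sym_mul (f g : Sym) : Sym :=
  MkSym (bij_comp (perm_bij f) (perm_bij g)).
Definition Sym_inv (f : Sym) : Sym := sval (cid (Sym_invP f)).

Lemma Sym_mulA : associative Sym_mul.
Proof. by move=> f g h; exact: Sym_ext. Qed.
Lemma Sym_mul1g : left_id Sym_one Sym_mul.
Proof. by move=> f; exact: Sym_ext. Qed.
Lemma Sym_mulg1 : right_id Sym_one Sym_mul.
Proof. by move=> f; exact: Sym_ext. Qed.
Lemma Sym_mulVg : left_inverse Sym_one Sym_inv Sym_mul.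
Proof.
move=> f; apply: Sym_ext => x /=.
by rewrite /Sym_inv; case: cid => g [/= fK _]; exact: fK.
Qed.
Lemma Sym_mulgV : right_inverse Sym_one Sym_inv Sym_mul.
Proof.
move=> f; apply: Sym_ext => x /=.
by rewrite /Sym_inv; case: cid => g [/= _ gK]; exact: gK.
Qed.

HB.instance Definition _ := isGroup.Build Sym
  Sym_mulA Sym_mul1g Sym_mulg1 Sym_mulVg Sym_mulgV.

End SymmetricGroup.

Record quandle := Quandle {
  qsort :> Type;
  qop : qsort -> qsort -> qsort;
  qop_bij : forall x, bijective (qop x);
  qop_distr : forall x y z, qop x (qop y z) = qop (qop x y) (qop x z);
  qop_idem : forall x, qop x x = x
}.

Definition left_translation (Q : quandle) (x : Q) : Sym Q :=
  MkSym (qop_bij x).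

Definition LMlt (Q : quandle) : set (Sym Q) :=
  generated (range (@left_translation Q)).

Arguments LMlt : clear implicits.

Definition connected_quandle (Q : quandle) : Prop :=
  forall x y : Q, exists2 f : Sym Q, LMlt Q f & f x = y.

Section Core.
Variable G : groupType.

Definition core_op (x y : G) : G := x * y^-1 * x.

Lemma core_opK x : involutive (core_op x).
Proof. by move=> y; rewrite /core_op !invgM invgK !mulgA mulgV mul1g mulgVK. Qed.

Lemma core_op_bij x : bijective (core_op x).
Proof. exact: inv_bij (core_opK x). Qed.

Lemma core_op_distr x y z :
  core_op x (core_op y z) = core_op (core_op x y) (core_op x z).
Proof. by rewrite /core_op !invgM !invgK !mulgA mulgK mulgVK. Qed.

Lemma core_op_idem x : core_op x x = x.
Proof. by rewrite /core_op mulgV mul1g. Qed.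

Definition Core : quandle := Quandle core_op_bij core_op_distr core_op_idem.

End Core.

Arguments Core : clear implicits.

Definition squares (G : groupType) : set G := [set x ^+ 2 | x in [set: G]].

Definition palindromic_products (G : groupType) : set G :=
  [set g | exists (t : nat) (x : 'I_t -> G),
     g = (\prod_(i < t) x i) * (\prod_(i < t) x (rev_ord i))].

Arguments squares : clear implicits.
Arguments palindromic_products : clear implicits.

(* Main.v *)
Require Import Defs.
From mathcomp Require Import all_boot all_classical.

(** Write L_x y = x y^-1 x. Since y^-1 (L_x y) = (y^-1 x)^2, the left
    multiplication group moves every y inside its coset modulo squares, so a
    connected core is generated by squares. Since L_x (L_1 y) = x y x, the
    orbit of 1 contains all palindromic products, so it is everything as soon
    as they exhaust G. Finally, palindromic products are stable under
    conjugation, hence under p |-> a^2 p = a (a p a^-1) a, so they contain the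
    subgroup generated by the squares. *)

Local Open Scope group_scope.
Local Open Scope classical_set_scope.

Lemma generated_sub (G : groupType) (S H : set G) :
  group_closed (fun x => x \in H) -> S `<=` H -> generated S `<=` H.
Proof. by move=> gH SH; apply: smallest_sub. Qed.

Lemma sub_generated (G : groupType) (S : set G) : S `<=` generated S.
Proof. exact: sub_gen_smallest. Qed.

(** Trades boolean membership for plain predicates, so that subgroup arguments can be run on sets in
    [Prop]. *)
Lemma group_closed_setP (G : groupType) (H : set G) :
  group_closed (fun x => x \in H) <->
  H 1 /\ forall u v, H u -> H v -> H (u / v).
Proof.
split=> -[H1 HV]; split.
- exact: set_mem.
- by move=> u v /mem_set Hu /mem_set Hv; apply: set_mem; apply: HV.
- exact: mem_set.
- by move=> u v /set_mem Hu /set_mem Hv; apply: mem_set; apply: HV.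
Qed.

Lemma generated_group_closed (G : groupType) (S : set G) :
  group_closed (fun x => x \in generated S).
Proof.
apply/group_closed_setP; split=> [H [/group_closed_setP[]//]|u v Su Sv H HS].
have [/group_closed_setP[_ HV] _] := HS.
by apply: HV; [apply: Su|apply: Sv].
Qed.

Section Generated.
Variables (G : groupType) (S : set G).

Lemma generated1 : generated S 1.
Proof. by have /group_closed_setP[] := generated_group_closed G S. Qed.

Lemma generatedF u v : generated S u -> generated S v -> generated S (u / v).
Proof.
by have /group_closed_setP[_] := generated_group_closed G S; apply.
Qed.

Lemma generatedV u : generated S u -> generated S u^-1.
Proof. by rewrite -div1g; apply: generatedF; apply: generated1. Qed.

Lemma generatedM u v : generated S u -> generated S v -> generated S (u * v).
Proof. by move=> Su /generatedV; rewrite -[v in u * v]invgK; apply: generatedF. Qed.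

End Generated.

Section Palindromes.
Variable G : groupType.
Implicit Types (a p x y : G).

Lemma palindromic1 : palindromic_products G 1.
Proof. by exists 0, (fun=> 1); rewrite !big_ord0 mulg1. Qed.

Lemma palindromic_wrap y p :
  palindromic_products G p -> palindromic_products G (y * p * y).
Proof.
move=> [t [x ->]].
(* The new letter [y] takes index 0 and the old letters shift up by one: [y] comes first in the
   increasing product and last in the reversed one. *)
exists t.+1, (fun i => if unlift ord0 i is Some j then x j else y).
rewrite big_ord_recl big_ord_recr /= unlift_none.
have -> : rev_ord ord_max = ord0 :> 'I_t.+1 by apply: val_inj; rewrite /= subnn.
rewrite unlift_none !mulgA; congr (_ * _ * _ * _).
  by apply: eq_bigr => i _; rewrite liftK.
apply: eq_bigr => i _.
have -> : rev_ord (widen_ord (leqnSn t) i) = lift ord0 (rev_ord i).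
  by apply: val_inj; rewrite /= /bump /= add1n subSn.
by rewrite liftK.
Qed.

(** Peeling off the outermost letter [x ord0] leaves a shorter palindrome, so induction on the
    length applies. *)
Lemma palindromic_ind (P : set G) :
  P 1 -> (forall y p, P p -> P (y * p * y)) -> palindromic_products G `<=` P.
Proof.
move=> P1 PS _ [t [x ->]]; elim: t x => [|t IHt] x.
  by rewrite !big_ord0 mulg1.
rewrite big_ord_recl big_ord_recr /=.
have -> : rev_ord ord_max = ord0 :> 'I_t.+1 by apply: val_inj; rewrite /= subnn.
have := PS (x ord0) _ (IHt (fun i => x (lift ord0 i))); rewrite !mulgA.
congr (P (_ * _ * _)); apply: eq_bigr => i _; congr (x _).
by apply: val_inj; rewrite /= /bump /= add1n subSn.
Qed.

(** Conjugation by [a] turns wrapping by [y] into wrapping by [a * y * a^-1]. *)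
Lemma palindromicJ a p :
  palindromic_products G p -> palindromic_products G (a * p * a^-1).
Proof.
apply: (palindromic_ind
  [set q | palindromic_products G (a * q * a^-1)]) => [|y q] /=.
  by rewrite mulg1 mulgV; apply: palindromic1.
by move=> /(palindromic_wrap (a * y * a^-1)); rewrite !mulgA !mulgVK.
Qed.

Lemma palindromic_sqrM a p :
  palindromic_products G p -> palindromic_products G (a ^+ 2 * p).
Proof.
by move=> /(palindromicJ a)/(palindromic_wrap a); rewrite expg2 !mulgA mulgVK.
Qed.

Lemma generated_squares_palindromic :
  generated (squares G) `<=` palindromic_products G.
Proof.
(* Closure of the palindromic products under multiplication is not evident, so one uses their
   stabilizer under left translation; the equivalence, rather than one implication, makes it closed
   under inverses. *)
pose H : set G :=
  [set g | forall p, palindromic_products G (g * p) <-> palindromic_products G p].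
suff HG : generated (squares G) `<=` H.
  by move=> g /HG/(_ 1)[_]; rewrite mulg1; apply; apply: palindromic1.
apply: generated_sub => [|_ [a _ <-] p].
  apply/group_closed_setP; split=> [p|u v Hu Hv p]; first by rewrite mul1g.
  by rewrite -mulgA Hu -Hv mulVKg.
(* Multiplying by the square of [a^-1] cancels [a ^+ 2]. *)
split=> [/(palindromic_sqrM a^-1)|]; last exact: palindromic_sqrM.
by rewrite expVgn mulKg.
Qed.

End Palindromes.

Section CoreConnected.
Variable G : groupType.

Lemma LMlt_Core_mod_squares (f : Sym (Core G)) (y : G) :
  LMlt (Core G) f -> generated (squares G) (y^-1 * f y).
Proof.
pose H : set (Sym (Core G)) :=
  [set h | forall z : G, generated (squares G) (z^-1 * h z)].
suff LH : LMlt (Core G) `<=` H by move=> /LH.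
apply: generated_sub => [|_ [a _ <-] z].
  apply/group_closed_setP; split=> [z|u v Hu Hv z] /=.
    by rewrite mulVg; apply: generated1.
  have vK : v (v^-1 z) = z.
    exact: (congr1 (fun h : Sym (Core G) => h z) (mulgV v)).
  set w : G := v^-1 z.
  (* As [z = v w], the displacement of [u / v] at [z] is a quotient of the displacements of [u] and
     [v] at [w]. *)
  have -> : z^-1 * u w = (w^-1 * v w)^-1 * (w^-1 * u w).
    by rewrite invgM invgK vK !mulgA mulgK.
  by apply: generatedM => //; apply: generatedV.
apply: sub_generated; exists (z^-1 * a) => //=.
by rewrite /core_op expg2 !mulgA.
Qed.

Lemma palindromic_LMlt_orbit (p : G) :
  palindromic_products G p ->
  exists2 f : Sym (Core G), LMlt (Core G) f & f (1 : G) = p.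
Proof.
pose L (x : Core G) := left_translation x.
have LL x : LMlt (Core G) (L x) by apply: sub_generated; exists x.
apply: (palindromic_ind G [set q : G |
  exists2 f : Sym (Core G), LMlt (Core G) f & f (1 : G) = q]) => [|y q [f Lf fq]].
  by exists 1 => //; apply: generated1.
exists (L y * (L 1 * f)) => /=.
  by apply: generatedM; [exact: LL | apply: generatedM; first exact: LL].
by rewrite fq /core_op mul1g mulg1 invgK.
Qed.

Lemma palindromic_connected :
  [set: G] = palindromic_products G -> connected_quandle (Core G).
Proof.
move=> GP x y.
have orbit1 (z : G) : exists2 f : Sym (Core G), LMlt (Core G) f & f (1 : G) = z.
  by apply: palindromic_LMlt_orbit; rewrite -GP.
have [f Lf <-] := orbit1 x; have [g Lg <-] := orbit1 y.
(* Go from [x] back to 1 by the inverse of [f], then on to [y] by [g]. *)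
exists (g / f); first exact: generatedF.
congr (g _).
exact: (congr1 (fun h : Sym (Core G) => h (1 : G)) (mulVg f)).
Qed.

End CoreConnected.

Theorem corollary3p7 (G : groupType) :
  [<-> connected_quandle (Core G);
       [set: G] = generated (squares G);
       [set: G] = palindromic_products G].
Proof.
tfae; last exact: palindromic_connected.
- move=> conn; apply/seteqP; split=> // x _.
  have [f Lf fx] := conn (1 : G) x.
  (* At the base point 1 the displacement is [x] itself. *)
  by have := LMlt_Core_mod_squares G f 1 Lf; rewrite fx invg1 mul1g.
- move=> GS; apply/seteqP; split=> // x.
  by rewrite GS; apply: generated_squares_palindromic.
Qed.
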